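(* Let $c$ and $d$ be positive integers with $c\ge 3$ and $d\ge 1$. Then there exists a connected, nontraceable detour graph with chromatic number $c$ and detour deficiency $d$.
   Context: All graphs are finite and simple; the order of a path is its number of vertices. For a vertex $v$, $\tau(v)$ is the order of a longest path in the graph having $v$ as an endvertex, and $\tau(G)$ is the order of a longest path in $G$. A detour graph is one in which all vertices have the same $\tau(v)$. Nontraceable means having no hamiltonian path. The detour deficiency of $G$ is $|V(G)|-\tau(G)$. *)

(* Defs.v *)
From mathcomp Require Import all_boot.
Set Implicit Arguments. Unset Strict Implicit. Unset Printing Implicit Defensive.

Section Graphs.
Variables (T : finType) (e : rel T).

Definition simple_graph : Prop := symmetric e /\ irreflexive e.

Definition is_gpath (p : seq T) : bool :=
  if p is x :: q then path e x q && uniq p else false.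

Definition endvertex (v : T) (p : seq T) : bool :=
  (head v p == v) || (last v p == v).

Definition tau_v (v : T) : nat :=
  \max_(n < #|T|.+1 | [exists t : n.-tuple T, is_gpath t && endvertex v t]) n.

Definition tau_G : nat :=
  \max_(n < #|T|.+1 | [exists t : n.-tuple T, is_gpath t]) n.

Definition detour_graph : Prop := forall u v : T, tau_v u = tau_v v.

Definition traceable : bool := [exists t : #|T|.-tuple T, is_gpath t].

Definition detour_deficiency : nat := #|T| - tau_G.

Definition connected_graph : Prop := forall x y : T, connect e x y.

Definition colourable (k : nat) : bool :=
  [exists f : {ffun T -> 'I_k}, [forall x, forall y, e x y ==> (f x != f y)]].

(* chromatic number: least k such that G is k-colourable (always <= #|T|) *)
Definition chromatic_number : nat :=
  \big[minn/#|T|]_(k < #|T|.+1 | colourable k) k.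

End Graphs.

(* Main.v *)
(** Take d+1 blocks in a ring. A block consists of two hubs, each a clique K_c
   with three distinguished ports, joined by two rungs: vertices of degree 2,
   each adjacent to one port of either hub. Every port has exactly one rung, the
   third rung of a hub linking it to the neighbouring block.
   On a path, two consecutive rungs are separated by a crossing of one hub, which
   uses up two of its three ports; so each of the 2(d+1) hubs is crossed at most
   once, at most 2(d+1)+1 of the 3(d+1) rungs are visited, and at least d
   vertices are missed. Conversely a path that leaves a block through one link,
   goes once around the ring missing one rung per block, and comes back through
   the other link can be completed inside the first block so as to miss nothing
   there and to end at any prescribed vertex of that block. A rung can be given
   the colour of a port to which it is not attached, so no colour is needed
   beyond those of the cliques. *)

Require Import Defs.
From mathcomp Require Import all_boot zify.
Set Implicit Arguments. Unset Strict Implicit. Unset Printing Implicit Defensive.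

(** * Auxiliary facts on sums, paths and minima *)

Lemma sum_eq1 (I : finType) (i0 : I) : \sum_i (i0 == i) = 1.
Proof.
by rewrite (bigD1 i0) //= eqxx big1 // => i /negPf; rewrite eq_sym => ->.
Qed.

(** Accounts for one crossing of the hub [i0]: its exit port and that port's partner form one more
    pair. *)
Lemma sum_half_bump (I : finType) (f : I -> nat) (i0 : I) :
  \sum_i (f i + (i0 == i) + (i0 == i))./2 = \sum_i (f i)./2 + 1.
Proof.
rewrite -(sum_eq1 i0) -big_split /=; apply: eq_bigr => i _.
by rewrite -addnA addnn halfD odd_double andbF doubleK.
Qed.

Lemma is_gpathE (T : finType) (e : rel T) p :
  is_gpath e p = [&& p != [::], sorted e p & uniq p].
Proof. by case: p. Qed.

Lemma bigmin_le (I : eqType) (r : seq I) (A : pred I) (F : I -> nat) n0 i :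
  i \in r -> A i -> \big[minn/n0]_(j <- r | A j) F j <= F i.
Proof.
elim: r => //= j r IH; rewrite inE big_cons => /predU1P[<- ->|ir Ai]; first exact: geq_minl.
by case: ifP => _; rewrite ?geq_min IH ?orbT.
Qed.

(** * The ring of blocks *)

Section Necklace.
Variables d m : nat.

(* Ports and rungs share their names: a rung named [r] is attached to the ports
   named [r]. The rungs [Some true] and [Some false] join the hubs [(i, false)]
   and [(i, true)] of block [i]; the rung [None] links [(i, true)] to
   [(ordS i, false)]. The [m] other vertices of a hub have no outside neighbour,
   so that c = m + 3. *)
Definition port := option bool.
Definition clique : finType := (port + 'I_m)%type.
Definition local : finType := ((bool * clique) + port)%type.
Definition vertex : finType := ('I_d.+1 * local)%type.
Definition hub : finType := ('I_d.+1 * bool)%type.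

(** Block containing the end on side [s] of the rung [r] of block [j]; only the link changes
    block. *)
Definition attach (j : 'I_d.+1) (s : bool) (r : port) : 'I_d.+1 :=
  if s || isSome r then j else ordS j.

Definition incident (i : 'I_d.+1) (h : bool * clique) (j : 'I_d.+1) (r : port) :=
  (h.2 == inl r) && (i == attach j h.1 r).

Definition necklace : rel vertex := fun u v =>
  match u.2, v.2 with
  | inl h, inl h' => [&& u.1 == v.1, h.1 == h'.1 & h.2 != h'.2]
  | inl h, inr r => incident u.1 h v.1 r
  | inr r, inl h => incident v.1 h u.1 r
  | inr _, inr _ => false
  end.

Lemma necklace_sym : symmetric necklace.
Proof.
move=> [i [[s k]|r]] [j [[s' k']|r']] //=.
by rewrite /necklace /= eq_sym (eq_sym s) (eq_sym k).
Qed.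

Lemma necklace_irr : irreflexive necklace.
Proof. by move=> [i [[s k]|r]] //=; rewrite /necklace /= !eqxx. Qed.

Lemma card_clique : #|clique| = m.+3.
Proof. by rewrite card_sum card_option card_bool card_ord. Qed.

Lemma card_vertex : #|vertex| = (d.+1 * (2 * m.+3 + 3)).
Proof.
rewrite card_prod card_ord card_sum card_prod card_bool.
by rewrite card_clique card_option card_bool.
Qed.

(** * Upper bound on the order of a path *)

Definition is_rung (v : vertex) := if v.2 is inr _ then true else false.

Definition hub_of (v : vertex) : option hub :=
  if v.2 is inl h then Some (v.1, h.1) else None.

Definition is_port_of (h : hub) (v : vertex) :=
  if v.2 is inl (s, inl _) then (v.1, s) == h else false.

(** Hence a port carries a single rung: a path entering a port by a rung cannot leave it by
    another. *)
Lemma attach_inj s r : injective (fun j => attach j s r).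
Proof. by move=> i j; rewrite /attach; case: ifP => // _ /ordS_inj. Qed.

(* Between two consecutive rungs the path crosses a hub, entering and leaving it
   through distinct ports; so crossings are paid for by pairs of visited ports.
   When the path starts inside a hub, the port by which it first leaves is
   credited with a partner. *)
Lemma rungs_le_port_pairs (x : vertex) (q : seq vertex) :
  path necklace x q -> uniq (x :: q) ->
  count is_rung (x :: q) <=
    \sum_h (count (is_port_of h) (x :: q) + (hub_of x == Some h))./2 + is_rung x.
Proof.
have [n] := ubnP (size q); elim: n => // n IHn in x q *.
case: q => [_ _ _|y q] /=; first by rewrite addn0 leq_addl.
rewrite ltnS => szq /andP[exy pq] /andP[xNq uq].
have IHy := IHn y q szq pq uq.
case: x y exy xNq pq uq IHy => [i [[s k]|r]] [j [[s' k']|r']] //.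
(* A move inside a hub keeps the credit on the same hub. *)
- rewrite /necklace /= => /and3P[/eqP<- /eqP<- _] _ _ _ IHy.
  rewrite !add0n addn0; apply: leq_trans IHy _; rewrite addn0.
  by apply: leq_sum => h _; apply: half_leq; rewrite leq_add2r leq_addl.
- rewrite /necklace /incident /= => /andP[/eqP-> iE] _ _ _.
  move=> IHy; apply: leq_trans IHy _.
  rewrite addn0 -(sum_half_bump _ (i, s)); apply: leq_sum => h _.
  apply: half_leq; rewrite addn0 add0n (inj_eq Some_inj) leq_add2r.
  by rewrite addnC.
(* The path enters a hub at the port [y]. If [z] is in that hub, [y] is the partner that was
   credited for [z]; if [z] is a rung, it is [x] again. *)
- rewrite /necklace /incident /= => /andP[/eqP-> /eqP jE] xNq pq uq _.
  rewrite add1n addn1 ltnS add0n.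
  case: q szq xNq pq uq => [|z q] //= szq xNq /andP[eyz pq] /andP[_ uq].
  have := IHn z q (ltnW szq) pq uq.
  case: z eyz xNq {pq uq} => [l [[t k'']|r'']].
    rewrite /necklace /= => /and3P[/eqP<- /eqP<- _] _ IHz.
    apply: leq_trans IHz _; rewrite addn0; apply: leq_sum => h _.
    by apply: half_leq; rewrite (inj_eq Some_inj) addn0 addnC.
  rewrite /necklace /incident /= => /andP[/eqP[<-] /eqP jE'].
  have -> : i = l by apply: (@attach_inj s' r); rewrite -jE.
  by rewrite !inE eqxx orbT.
Qed.

Lemma count_port_le (h : hub) (p : seq vertex) :
  uniq p -> count (is_port_of h) p <= 3.
Proof.
move=> up; have <- : size [seq (h.1, inl (h.2, inl r)) : vertex | r <- enum {: port}] = 3.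
  by rewrite size_map -cardE card_option card_bool.
rewrite -size_filter; apply: uniq_leq_size; first exact: filter_uniq.
case=> i [[s [r|x]]|r]; rewrite mem_filter /is_port_of //= => /andP[/eqP<- _].
by apply/mapP; exists r; rewrite ?mem_enum.
Qed.

Lemma count_nonrung_le (p : seq vertex) :
  uniq p -> count (predC is_rung) p <= d.+1 * (2 * m.+3).
Proof.
move=> up.
have <- : size [seq (a.1, inl a.2) : vertex | a <- enum {: 'I_d.+1 * (bool * clique)}]
    = d.+1 * (2 * m.+3).
  by rewrite size_map -cardE !card_prod card_ord card_bool card_clique.
rewrite -size_filter; apply: uniq_leq_size; first exact: filter_uniq.
case=> i [a|r]; rewrite mem_filter //= => _.
by apply/mapP; exists (i, a); rewrite ?mem_enum.
Qed.

(** All hub vertices, plus one rung more than there are hubs. *)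
Definition detour := d.+1 * (2 * m.+3) + (2 * d.+1).+1.

Lemma gpath_size_le (p : seq vertex) : is_gpath necklace p -> size p <= detour.
Proof.
case: p => // x q /andP[pq uq].
rewrite -(count_predC is_rung (x :: q)) addnC leq_add ?count_nonrung_le //.
apply: leq_trans (rungs_le_port_pairs pq uq) _.
(* Three ports give one pair, or two with the credit. Only one hub can have the credit, and none has
   it if [x] is a rung. *)
apply: (@leq_trans (\sum_(h : hub) (1 + (hub_of x == Some h)) + is_rung x)).
  rewrite leq_add2r; apply: leq_sum => h _.
  by have := count_port_le h uq; case: eqP => _; lia.
rewrite big_split /= sum1_card card_prod card_ord card_bool (mulnC _ 2) -addnA.
rewrite -[X in _ <= X]addn1 leq_add2l.
case: x {pq uq} => i [[s k]|r] /=; last by rewrite big1.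
by rewrite addn0 -(sum_eq1 (i, s)); apply: leq_sum => h _; rewrite (inj_eq Some_inj).
Qed.

(* Adjacency inside a block; the rung [None] is counted with the hub [true] of its
   own block only. *)
Definition local_adj : rel local := fun a b =>
  match a, b with
  | inl h, inl h' => (h.1 == h'.1) && (h.2 != h'.2)
  | inl h, inr r | inr r, inl h => (h.2 == inl r) && (h.1 || isSome r)
  | inr _, inr _ => false
  end.

Lemma necklace_local i a b : local_adj a b -> necklace (i, a) (i, b).
Proof.
by case: a b => [h|r] [h'|r'] //=; rewrite /necklace /incident /= ?eqxx //;
   case/andP=> -> sr; rewrite /attach sr eqxx.
Qed.

(** * Paths inside one block *)

Definition in_port s r : local := inl (s, inl r).
Definition extras s (xs : seq 'I_m) : seq local := [seq inl (s, inr x) | x <- xs].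
Definition link : local := inr None.
Definition entry : local := in_port false None.

Lemma path_extras s k xs :
  uniq (k :: [seq inr x | x <- xs]) -> path local_adj (inl (s, k)) (extras s xs).
Proof.
elim: xs k => //= x xs IH k /andP[]; rewrite inE negb_or => /andP[kx _] u.
by rewrite eqxx kx IH.
Qed.

Lemma path_extras_port s r xs : uniq xs -> path local_adj (in_port s r) (extras s xs).
Proof.
move=> u; apply: path_extras; rewrite /= map_inj_uniq ?u ?andbT; last by move=> ? ? [].
by apply/mapP => -[].
Qed.

(** A clique can be crossed through its other vertices in any order; with [xs] empty the crossing is
    the edge between two ports, whence [r != r']. *)
Lemma path_extras_cat s r xs r' t : uniq xs -> r != r' ->
  path local_adj (in_port s r) (extras s xs ++ in_port s r' :: t) =
  path local_adj (in_port s r') t.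
Proof.
move=> u rr'; rewrite cat_path path_extras_port //=.
case/lastP: xs {u} => [|xs x]; first by rewrite /= eqxx (inj_eq (@inl_inj _ _)) rr'.
by rewrite /extras map_rcons last_rcons /= eqxx.
Qed.

Lemma sorted_extras_cat s xs r t : uniq xs ->
  sorted local_adj (extras s xs ++ in_port s r :: t) = path local_adj (in_port s r) t.
Proof.
case: xs => //= x xs u; rewrite cat_path path_extras.
  by rewrite /extras (last_map _ xs x) /= eqxx.
by rewrite -[_ :: _](map_cons inr) map_inj_uniq // => ? ? [].
Qed.

Definition is_extra (a : local) := if a is inl (_, inr _) then true else false.

(** Separates the symbolic part of an explicit path, its extras, from its ports and rungs, whose
    distinctness is settled by computation. *)
Lemma uniq_filter_extra (s : seq local) :
  uniq s = uniq [seq a <- s | is_extra a] && uniq [seq a <- s | ~~ is_extra a].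
Proof.
have /permPl/perm_uniq <- := perm_filterC is_extra s; rewrite cat_uniq; congr (_ && _).
rewrite -[RHS]andTb; congr (_ && _); apply/hasPn => a.
by rewrite !mem_filter /= => /andP[/negPf->].
Qed.

Lemma filter_extras s xs : filter is_extra (extras s xs) = extras s xs.
Proof. by elim: xs => //= x xs ->. Qed.

Lemma filter_extrasC s xs : [seq a <- extras s xs | ~~ is_extra a] = [::].
Proof. by elim: xs. Qed.

Lemma uniq_extras s xs : uniq (extras s xs) = uniq xs.
Proof. by rewrite map_inj_uniq // => ? ? []. Qed.

Lemma uniq_extras_cat s s' xs ys :
  s != s' -> uniq xs -> uniq ys -> uniq (extras s xs ++ extras s' ys).
Proof.
move=> ss' ux uy; rewrite cat_uniq !uniq_extras ux uy andbT; apply/hasPn => a /mapP[y _ ->].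
by apply/mapP => -[x _ [/esym/eqP]]; rewrite (negPf ss').
Qed.

(** Misses only the rung [Some false] of its block. *)
Definition lap : seq local :=
  [:: entry, in_port false (Some false) & extras false (enum 'I_m)] ++
  [:: in_port false (Some true), inr (Some true), in_port true (Some true),
      in_port true (Some false) & extras true (enum 'I_m)] ++
  [:: in_port true None; link].

Lemma path_lap : path local_adj entry (behead lap).
Proof. by rewrite /= path_extras_cat ?enum_uniq //= path_extras_cat ?enum_uniq. Qed.

Lemma uniq_lap : uniq lap.
Proof.
rewrite uniq_filter_extra /lap !filter_cat /= !filter_extras !filter_extrasC /=.
by rewrite cats0 uniq_extras_cat ?enum_uniq.
Qed.

Lemma size_lap : size lap = (2 * m.+3).+2.
Proof.
have := size_enum_ord m; rewrite /lap; move: (enum _) => xs szxs.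
by rewrite !size_cat /= !size_map szxs; lia.
Qed.

(** * Going around the ring *)

Definition laps (js : seq 'I_d.+1) : seq vertex :=
  flatten [seq [seq (i, a) | a <- lap] | i <- js].

Lemma laps_cons i js : laps (i :: js) = [seq (i, a) | a <- lap] ++ laps js.
Proof. by []. Qed.

Lemma mem_laps js v : v \in laps js -> v.1 \in js.
Proof. by case/flatten_mapP => i ijs /mapP[a _ ->]. Qed.

Lemma uniq_laps js : uniq js -> uniq (laps js).
Proof.
elim: js => // i js IH /andP[iN u]; rewrite laps_cons cat_uniq IH // andbT.
rewrite map_inj_uniq ?uniq_lap; last by move=> ? ? [].
apply/hasPn => v /mem_laps vis; apply/mapP => -[a _ vE].
by rewrite vE (negPf iN) in vis.
Qed.

Lemma size_laps js : size (laps js) = size js * (2 * m.+3).+2.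
Proof. by elim: js => // i js IH; rewrite laps_cons size_cat IH size_map size_lap. Qed.

Lemma path_block i a s :
  path local_adj a s -> path necklace (i, a) [seq (i, b) | b <- s].
Proof.
rewrite path_map; apply: sub_path => b b'; exact: necklace_local.
Qed.

Lemma link_entry i : necklace (i, link) (ordS i, entry).
Proof. by rewrite /necklace /incident /attach /= !eqxx. Qed.

Lemma path_to_entry i s : path local_adj entry s ->
  path necklace (i, link) [seq (ordS i, a) | a <- entry :: s].
Proof. by move=> ps; rewrite /= link_entry path_block. Qed.

Lemma last_lap i (v : vertex) : last v [seq (i, a) | a <- lap] = (i, link).
Proof. by rewrite /lap !catA map_cat last_cat. Qed.

(** Each lap is entered through the link of the preceding block and stops at its own link, where the
    next one begins. *)
Lemma path_laps i js j s : fpath (@ordS d.+1) i (rcons js j) ->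
  path local_adj entry s ->
  path necklace (i, link) (laps js ++ [seq (j, a) | a <- entry :: s]).
Proof.
move=> + ps; elim: js i => [|i' js IH] i /andP[/eqP<-] pjs; first exact: path_to_entry.
by rewrite laps_cons -catA cat_path last_lap (path_to_entry i path_lap) IH.
Qed.

Lemma val_iter_ordS k (j : 'I_d.+1) : iter k (@ordS d.+1) j = (j + k) %% d.+1 :> nat.
Proof.
elim: k => [|k IH] /=; first by rewrite addn0 modn_small.
by rewrite IH -addn1 modnDml addn1 addnS.
Qed.

Lemma iter_ordS_id (j : 'I_d.+1) : iter d.+1 (@ordS d.+1) j = j.
Proof. by apply: val_inj; rewrite [LHS]val_iter_ordS modnDr modn_small. Qed.

Lemma uniq_traject_ordS (j : 'I_d.+1) : uniq (traject (@ordS d.+1) j d.+1).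
Proof.
rewrite -(map_inj_uniq val_inj).
have -> : [seq val i | i <- traject (@ordS d.+1) j d.+1] =
    [seq (j + k) %% d.+1 | k <- iota 0 d.+1].
  apply: (@eq_from_nth _ 0) => [|k]; rewrite !size_map size_traject ?size_iota // => kd.
  rewrite (nth_map j) ?size_traject // nth_traject // [LHS]val_iter_ordS.
  by rewrite (nth_map 0) ?size_iota // nth_iota.
rewrite map_inj_in_uniq ?iota_uniq // => k l; rewrite !mem_iota => kd ld.
by move=> /eqP; rewrite eqn_modDl !modn_small // => /eqP.
Qed.

(* The first block is covered by two pieces: [al] leaves it through [link], and
   [be] enters it through [entry] after one turn around the ring. *)
Lemma long_gpath j (al be : seq local) v0 :
  sorted local_adj (rcons al link) -> path local_adj entry be ->
  uniq (rcons al link ++ entry :: be) -> size al + size be = 2 * m.+3 + 1 ->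
  exists p : seq vertex, [/\ is_gpath necklace p, size p = detour,
    head v0 p = (j, head link al) & last v0 p = (j, last entry be)].
Proof.
move=> pal pbe u sz; set js := traject (@ordS d.+1) (ordS j) d.
exists ([seq (j, a) | a <- al] ++ (j, link) :: laps js ++ [seq (j, a) | a <- entry :: be]).
have /andP[jN ujs] : (j \notin js) && uniq js := uniq_traject_ordS j.
split.
- rewrite is_gpathE sorted_cat_cons -(map_rcons (pair j)); apply/and3P; split.
  + by case: (al).
  + apply/andP; split.
      by rewrite sorted_map; apply: sub_sorted pal => ? ?; exact: necklace_local.
    apply: path_laps => //.
    have -> : rcons js j = traject (@ordS d.+1) (ordS j) d.+1.
      by rewrite trajectSr -iterSr iter_ordS_id.
    exact: fpath_traject.
  + rewrite -cat_rcons -(map_rcons (pair j)).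
    set t := [seq (j, a) | a <- rcons al link ++ entry :: be].
    rewrite -(perm_uniq (s1 := laps js ++ t)); last by rewrite /t map_cat perm_catCA.
    rewrite cat_uniq uniq_laps // map_inj_uniq ?u ?andbT; last by move=> ? ? [].
    apply/hasPn => v /mapP[a _ ->]; apply/negP => /mem_laps /=.
    by rewrite (negPf jN).
(* Each of the [d] laps misses one rung; [al] and [be] together hold all of block [j] except [link]
   and [entry], which are counted separately. *)
- rewrite size_cat /= size_cat size_laps size_traject /= !size_map /detour.
  by move: (size al) (size be) (2 * m.+3) sz => a b t sz; lia.
- by case: (al).
- by rewrite last_cat /= last_cat /= (last_map (pair j)).
Qed.

(** * Longest paths ending at a prescribed vertex *)

Definition long_end (v : vertex) : Prop :=
  exists p : seq vertex, [/\ is_gpath necklace p, size p = detour & endvertex v p].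

Lemma long_end_head j al be :
  sorted local_adj (rcons al link) -> path local_adj entry be ->
  uniq (rcons al link ++ entry :: be) -> size al + size be = 2 * m.+3 + 1 ->
  long_end (j, head link al).
Proof.
move=> sal pbe u sz; have [p [gp szp hp _]] := long_gpath j (j, head link al) sal pbe u sz.
by exists p; rewrite /endvertex hp eqxx.
Qed.

Lemma long_end_last j al be :
  sorted local_adj (rcons al link) -> path local_adj entry be ->
  uniq (rcons al link ++ entry :: be) -> size al + size be = 2 * m.+3 + 1 ->
  long_end (j, last entry be).
Proof.
move=> sal pbe u sz; have [p [gp szp _ lp]] := long_gpath j (j, last entry be) sal pbe u sz.
by exists p; rewrite /endvertex lp eqxx orbT.
Qed.

Section Ends.
Variables (b : bool) (xs ys : seq 'I_m).
Hypotheses (uxs : uniq xs) (uys : uniq ys) (szxs : size xs = m) (szys : size ys = m).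
Local Notation P := (Some b).
Local Notation Q := (Some (~~ b)).

(** Here and below, [b] allows the two inner rungs to be exchanged, and the free orders [xs], [ys]
    allow any extra to come first or last. Both ends of the constructed path are recorded. *)
Lemma long_end_link j : long_end (j, link) /\ long_end (j, in_port false Q).
Proof.
pose be := extras false xs ++ [:: in_port false P, inr P, in_port true P,
  in_port true None & extras true ys ++ [:: in_port true Q; inr Q; in_port false Q]].
have pbe : path local_adj entry be.
  by rewrite path_extras_cat //= path_extras_cat //= !eqxx; case: (b).
have ube : uniq (link :: entry :: be).
  rewrite uniq_filter_extra; apply/andP; split; rewrite /be /= !filter_cat /= !filter_cat
      ?filter_extras ?filter_extrasC /=.
    by rewrite ?cats0 uniq_extras_cat.
  by case: (b).
have sz : size be = 2 * m.+3 + 1.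
  by rewrite /be /= ?size_cat /= ?size_cat /= !size_map szxs szys; lia.
split; first exact: (@long_end_head j [::] be).
have := @long_end_last j [::] be isT pbe ube sz.
by rewrite last_cat /= last_cat.
Qed.

(** Both ports of the rung [P] precede it in [be], so the path can stop on it. *)
Lemma long_end_rung j : long_end (j, inr P) /\ long_end (j, in_port true None).
Proof.
pose be := extras false xs ++ [:: in_port false P, in_port false Q, inr Q,
  in_port true Q & extras true ys ++ [:: in_port true P; inr P]].
have pbe : path local_adj entry be.
  by rewrite path_extras_cat //= path_extras_cat //= ?eqxx; case: (b).
have ube : uniq ([:: in_port true None; link] ++ entry :: be).
  rewrite uniq_filter_extra; apply/andP; split; rewrite /be /= !filter_cat /= !filter_cat
      ?filter_extras ?filter_extrasC /=.
    by rewrite ?cats0 uniq_extras_cat.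
  by case: (b).
have sz : size [:: in_port true None] + size be = 2 * m.+3 + 1.
  by rewrite /be /= ?size_cat /= ?size_cat /= !size_map szxs szys; lia.
split; last exact: (@long_end_head j [:: in_port true None] be).
have := @long_end_last j [:: in_port true None] be isT pbe ube sz.
by rewrite last_cat /= last_cat.
Qed.

(** The whole block except [entry] is covered before the turn around the ring. *)
Lemma long_end_port j : long_end (j, in_port true Q) /\ long_end (j, entry).
Proof.
pose al := [:: in_port true Q, inr Q, in_port false Q & extras false xs ++
  [:: in_port false P, inr P, in_port true P & extras true ys ++ [:: in_port true None]]].
have sal : sorted local_adj (rcons al link).
  by rewrite /= rcons_cat /= rcons_cat /= path_extras_cat //= ?path_extras_cat //=
    ?eqxx; case: (b).
have u : uniq (rcons al link ++ [:: entry]).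
  rewrite cat_rcons /al uniq_filter_extra; apply/andP; split;
    rewrite !filter_cat /= !filter_cat /= !filter_cat
      ?filter_extras ?filter_extrasC /=.
    by rewrite ?cats0 uniq_extras_cat.
  by case: (b).
have sz : size al + size (Nil local) = 2 * m.+3 + 1.
  by rewrite /al /= ?size_cat /= ?size_cat /= !size_map szxs szys; lia.
split; first exact: (@long_end_head j al [::]).
exact: (@long_end_last j al [::]).
Qed.

Lemma long_end_extra0 j x zs : xs = rcons zs x -> long_end (j, inl (false, inr x)).
Proof.
move=> xsE.
pose be := [:: in_port false Q, inr Q, in_port true Q & extras true ys ++
  [:: in_port true P, inr P, in_port false P & extras false xs]].
have pbe : path local_adj entry be.
  by rewrite /= path_extras_cat //= ?path_extras_port //= ?eqxx; case: (b).
have ube : uniq ([:: in_port true None; link] ++ entry :: be).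
  rewrite uniq_filter_extra; apply/andP; split; rewrite /be /= !filter_cat /=
      ?filter_extras ?filter_extrasC /=.
    by rewrite ?cats0 uniq_extras_cat.
  by case: (b).
have sz : size [:: in_port true None] + size be = 2 * m.+3 + 1.
  by rewrite /be /= ?size_cat /= ?size_cat /= !size_map szxs szys; lia.
have := @long_end_last j [:: in_port true None] be isT pbe ube sz.
by rewrite /= last_cat /= xsE /extras map_rcons last_rcons.
Qed.

Lemma long_end_extra1 j y zs : ys = y :: zs -> long_end (j, inl (true, inr y)).
Proof.
move=> ysE.
pose al := extras true ys ++ [:: in_port true P, inr P, in_port false P &
  extras false xs ++ [:: in_port false Q; inr Q; in_port true Q; in_port true None]].
have sal : sorted local_adj (rcons al link).
  by rewrite rcons_cat /= rcons_cat sorted_extras_cat //= path_extras_cat //= ?eqxx; case: (b).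
have u : uniq (rcons al link ++ [:: entry]).
  rewrite cat_rcons /al uniq_filter_extra; apply/andP; split;
    rewrite !filter_cat /= !filter_cat /=
      ?filter_extras ?filter_extrasC /=.
    by rewrite ?cats0 uniq_extras_cat.
  by case: (b).
have sz : size al + size (Nil local) = 2 * m.+3 + 1.
  by rewrite /al /= ?size_cat /= ?size_cat /= !size_map szxs szys; lia.
have := @long_end_head j al [::] sal isT u sz.
by rewrite /al ysE.
Qed.

End Ends.

Lemma all_long_end v : long_end v.
Proof.
have ue := enum_uniq 'I_m; have se : size (enum 'I_m) = m := size_enum_ord m.
(* Some ports are reached in the role of [Q], so the lemmas are applied with [~~ b]. *)
have bE b : Some b = Some (~~ (~~ b)) :> port by rewrite negbK.
case: v => j [[s [[b|]|x]]|[b|]].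
- by rewrite bE; case: s;
    [case: (long_end_port (~~ b) ue ue se se j) | case: (long_end_link (~~ b) ue ue se se j)].
- by case: s; [case: (long_end_rung true ue ue se se j) | case: (long_end_port true ue ue se se j)].
- have xe : x \in enum 'I_m by rewrite mem_enum.
  (* The extras are reordered to bring [x] to the end of the path. *)
  have ur : uniq (x :: rem x (enum 'I_m)) by rewrite /= mem_rem_uniqF ?rem_uniq.
  have szr : size (x :: rem x (enum 'I_m)) = m.
    by rewrite /= size_rem // se prednK // -se; case: (enum _) xe.
  case: s; first exact: (long_end_extra1 true ue ur se szr).
  apply: (@long_end_extra0 true (rcons (rem x (enum 'I_m)) x) (enum 'I_m)) => //.
    by rewrite rcons_uniq.
  by rewrite size_rcons.
- by case: (long_end_rung b ue ue se se j).
- by case: (long_end_link true ue ue se se j).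
Qed.

(** * Detour order, deficiency and connectedness *)

Lemma necklace_tau_v v : tau_v necklace v = detour.
Proof.
have [p [gp szp ep]] := all_long_end v.
apply/eqP; rewrite eqn_leq; apply/andP; split.
  apply/bigmax_leqP => n /existsP[t /andP[gt _]].
  by rewrite -(size_tuple t) gpath_size_le.
have dV : detour < #|vertex|.+1 by rewrite ltnS card_vertex /detour; lia.
apply: (@leq_bigmax_cond _ _ _ (Ordinal dV)); apply/existsP => /=.
by move/eqP: szp => szp; exists (Tuple szp); rewrite gp ep.
Qed.

Lemma necklace_tau_G : tau_G necklace = detour.
Proof.
apply/eqP; rewrite eqn_leq; apply/andP; split.
  apply/bigmax_leqP => n /existsP[t gt].
  by rewrite -(size_tuple t) gpath_size_le.
rewrite -(necklace_tau_v (ord0, link)); apply/bigmax_leqP => n /existsP[t /andP[gt _]].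
by apply: (@leq_bigmax_cond _ _ _ n); apply/existsP; exists t.
Qed.

Lemma necklace_deficiency : detour_deficiency necklace = d.
Proof. by rewrite /detour_deficiency necklace_tau_G card_vertex /detour; lia. Qed.

Lemma necklace_nontraceable : 0 < d -> ~~ traceable necklace.
Proof.
move=> d0; apply/existsP => -[t /gpath_size_le].
by rewrite size_tuple card_vertex /detour; lia.
Qed.

Lemma necklace_connected : connected_graph necklace.
Proof.
have cS := sym_connect_sym necklace_sym.
have hubC i s k k' : connect necklace (i, inl (s, k)) (i, inl (s, k')).
  have [->|kk'] := eqVneq k k'; first exact: connect0.
  by apply: connect1; rewrite /necklace /= !eqxx.
have toEntry i a : connect necklace (i, entry) (i, a).
  have hubT k : connect necklace (i, entry) (i, inl (true, k)).
    apply: connect_trans (hubC i true (inl (Some true)) k).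
    apply: connect_trans (hubC i false (inl None) (inl (Some true))) _.
    by apply: (@connect_trans _ _ (i, inr (Some true)));
      apply/connect1/necklace_local.
  case: a => [[[] k]|r]; [exact: hubT | exact: hubC |]; apply: connect_trans (hubT (inl r)) _.
  by apply/connect1/necklace_local; rewrite /= eqxx.
have step i : connect necklace (i, entry) (ordS i, entry).
  by apply: connect_trans (toEntry i link) (connect1 (link_entry i)).
have from0 (i : 'I_d.+1) : connect necklace (ord0, entry) (i, entry).
  have -> : i = iter i (@ordS d.+1) ord0.
    by apply: val_inj; rewrite [RHS]val_iter_ordS add0n modn_small.
  elim: (nat_of_ord i) => [|k IH]; first exact: connect0.
  exact: connect_trans IH (step _).
move=> [i a] [j a']; apply: (@connect_trans _ _ (ord0, entry)).
  by rewrite cS; exact: connect_trans (from0 i) (toEntry i a).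
exact: connect_trans (from0 j) (toEntry j a').
Qed.

(** * Chromatic number *)

Definition colour (v : vertex) : clique :=
  match v.2 with
  | inl h => h.2
  | inr r => inl (if r is Some _ then None else Some true)
  end.

Lemma colour_proper u v : necklace u v -> colour u != colour v.
Proof.
case: u v => i [[s k]|r] [j [[s' k']|r']]; rewrite /necklace /incident /colour //=.
- by case/and3P.
- by case/andP => /eqP-> _; case: r'.
- by case/andP => /eqP-> _; case: r.
Qed.

(** A colouring is injective on the clique of a single hub. *)
Lemma necklace_colourable k : colourable necklace k -> m.+3 <= k.
Proof.
case/existsP => f /forallP pf; rewrite -card_clique -(card_ord k).
apply: (@leq_card _ _ (fun x : clique => f (ord0, inl (true, x)))) => x y /eqP fxy.
apply/eqP; apply: contraTT fxy => xy.
by apply: (implyP (forallP (pf _) _)); rewrite /necklace /= ?eqxx.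
Qed.

Lemma necklace_chromatic : chromatic_number necklace = m.+3.
Proof.
have cV : m.+3 <= #|vertex| by rewrite card_vertex; lia.
apply/eqP; rewrite eqn_leq; apply/andP; split; last first.
  (* The default value [#|vertex|] of the minimum must also be at least [m.+3], which is [cV]. *)
  rewrite /chromatic_number; elim/big_ind: _ => // [x y mx my|k /necklace_colourable //].
  by rewrite leq_min mx.
have cV' : m.+3 < #|vertex|.+1 by [].
apply: (@bigmin_le _ _ _ (fun k : 'I__ => nat_of_ord k) _ (Ordinal cV')).
  exact: mem_index_enum.
rewrite /= -card_clique; apply/existsP; exists [ffun v => enum_rank (colour v)].
apply/forallP => u; apply/forallP => v; apply/implyP => uv.
by rewrite !ffunE (inj_eq enum_rank_inj) colour_proper.
Qed.

End Necklace.

Theorem theorem2p26 (c d : nat) (hc : 3 <= c) (hd : 1 <= d) :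
  exists (T : finType) (e : rel T),
    [/\ simple_graph e, connected_graph e, ~~ traceable e, detour_graph e
      & chromatic_number e = c /\ detour_deficiency e = d].
Proof.
exists (vertex d (c - 3)), (@necklace d (c - 3)); split.
- by split; [exact: necklace_sym | exact: necklace_irr].
- exact: necklace_connected.
- exact: necklace_nontraceable.
- by move=> u v; rewrite !necklace_tau_v.
- by rewrite necklace_chromatic necklace_deficiency -addn3 subnK.
Qed.
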